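(* Let $F=(F_0:\cdots:F_n)$ and $S$ be as in the context, with conditions $( * )$, $(a)$, $(b)$ satisfied, and let $G,H$ be constructed as described (with $G=H=F$ if $\mathcal{A}=\emptyset$). Then \[S=\{F(1:s:t)\}\cup\{G(s:1:t)\}\cup\{H(s:t:1)\},\] where each set ranges over those $(s,t)\in\mathbb{K}^2$ at which the respective tuple is not identically zero; i.e. the union of the images of the three maps $\mathbb{A}^2\dashrightarrow S$, $(s,t)\mapsto F(1:s:t)$, $(s,t)\mapsto G(s:1:t)$, $(s,t)\mapsto H(s:t:1)$, is all of $S$.
   Context: $\mathbb{K}$ is an algebraically closed field of characteristic zero. $F_0,\dots,F_n\in\mathbb{K}[x_0,x_1,x_2]$ are homogeneous with $\gcd(F_0,\dots,F_n)=1$, all nonzero ones of the same degree, defining $F=(F_0:\cdots:F_n):\mathbb{P}^2\dashrightarrow\mathbb{P}^n$; $S\subset\mathbb{P}^n$ is the Zariski closure of its image, a surface. Base locus: $\mathcal{A}=\{P\in\mathbb{P}^2: F_0(P)=\cdots=F_n(P)=0\}$, finite. Conditions: $( * )$ if $\mathcal{A}\ne\emptyset$, for every $P\in\mathcal{A}$ the Jacobian matrix $\left(\frac{\partial F_i}{\partial x_j}(P)\right)$ has rank $2$; $(a)$ no point of $\mathcal{A}$ lies on $\{x_0=0\}$, $\{x_1=0\}$ or $\{x_2=0\}$; $(b)$ for distinct $P,Q\in\mathcal{A}$ the line $PQ$ contains none of $(1:0:0),(0:1:0),(0:0:1)$. If $\mathcal{A}\neq\emptyset$: the reduced lexicographic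 ($x_0<x_1<x_2$) Gröbner bases of $I_1=(F_0,\dots,F_n,x_1-1)$ and $I_2=(F_0,\dots,F_n,x_2-1)$ have the form $\{x_2-q_1(x_0),x_1-1,p_1(x_0)\}$ and $\{x_2-1,x_1-q_2(x_0),p_2(x_0)\}$ with $p_i,q_i\in\mathbb{K}[x_0]$, $\deg p_i=k>\deg q_i$, $k=|\mathcal{A}|$. Put $\mathbf{P}_1(x_0,x_1)=p_1(x_0/x_1)x_1^k$, $\mathbf{Q}_1(x_0,x_1)=q_1(x_0/x_1)x_1^{k-1}$, $\mathbf{P}_2(x_0,x_2)=p_2(x_0/x_2)x_2^k$, $\mathbf{Q}_2(x_0,x_2)=q_2(x_0/x_2)x_2^{k-1}$; $\widetilde G_i=F_i\big(x_0x_1^k,\ x_1^{k+1},\ x_1^2\mathbf{Q}_1+x_2\mathbf{P}_1\big)$, $\widetilde H_i=F_i\big(x_0x_2^k,\ x_2^2\mathbf{Q}_2+x_1\mathbf{P}_2,\ x_2^{k+1}\big)$, $G_i=\widetilde G_i/\gcd(\widetilde G_0,\dots,\widetilde G_n)$, $H_i=\widetilde H_i/\gcd(\widetilde H_0,\dots,\widetilde H_n)$. *)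

(* Defs.v *)
From HB Require Import structures.
From mathcomp Require Import all_boot all_order all_algebra.
From mathcomp Require Import mpoly.
Set Implicit Arguments. Unset Strict Implicit. Unset Printing Implicit Defensive.
Import Order.TTheory GRing.Theory Num.Theory.
Local Open Scope ring_scope.

Section Defs.
Variable K : fieldType.

(** Points of K^m, i.e. representatives of points of P^(m-1). *)
Definition nonzero (m : nat) (v : 'I_m -> K) : Prop := exists i, v i != 0.

Definition proj_eq (m : nat) (v w : 'I_m -> K) : Prop :=
  nonzero w /\ exists c : K, c != 0 /\ forall i, v i = c * w i.

Definition pt3 (a b c : K) : 'I_3 -> K :=
  fun i => match val i with 0%N => a | 1%N => b | _ => c end.

Definition X0 : {mpoly K[3]} := 'X_(@Ordinal 3 0 isT).
Definition X1 : {mpoly K[3]} := 'X_(@Ordinal 3 1 isT).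
Definition X2 : {mpoly K[3]} := 'X_(@Ordinal 3 2 isT).

Definition evalmap (n : nat) (F : 'I_n.+1 -> {mpoly K[3]}) (u : 'I_3 -> K)
  : 'I_n.+1 -> K := fun i => (F i).@[u].

(** Homogeneity: all F_i homogeneous of one common degree d (0 is homogeneous
    of every degree).  That not all F_i vanish follows from S being a surface. *)
Definition homog_family (n : nat) (F : 'I_n.+1 -> {mpoly K[3]}) : Prop :=
  exists d : nat, forall i, F i \is d.-homog.

Definition mdvd (m : nat) (d p : {mpoly K[m]}) : Prop := exists q, p = q * d.
Definition coprime_family (n : nat) (F : 'I_n.+1 -> {mpoly K[3]}) : Prop :=
  forall d : {mpoly K[3]}, (forall i, mdvd d (F i)) ->
    exists c : K, c != 0 /\ d = c%:MP.

Definition base_pt (n : nat) (F : 'I_n.+1 -> {mpoly K[3]}) (u : 'I_3 -> K) : Prop :=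
  nonzero u /\ forall i, (F i).@[u] = 0.

Definition image_pt (n : nat) (F : 'I_n.+1 -> {mpoly K[3]}) (w : 'I_n.+1 -> K) : Prop :=
  exists u : 'I_3 -> K, nonzero u /\ ~ base_pt F u /\ forall i, w i = (F i).@[u].

(** Projective Zariski-closed subsets of P^(m-1), represented as sets of
    nonzero vectors of K^m: common zero sets of families of homogeneous
    polynomials. *)
Definition is_homog (m : nat) (p : {mpoly K[m]}) : Prop := exists d : nat, p \is d.-homog.

Definition proj_closed (m : nat) (X : ('I_m -> K) -> Prop) : Prop :=
  exists P : {mpoly K[m]} -> Prop, (forall p, P p -> is_homog p) /\
    forall v, X v <-> (nonzero v /\ forall p, P p -> p.@[v] = 0).

Definition zclosure (m : nat) (X : ('I_m -> K) -> Prop) : ('I_m -> K) -> Prop :=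
  fun v => nonzero v /\ forall p : {mpoly K[m]}, is_homog p ->
    (forall w, X w -> p.@[w] = 0) -> p.@[v] = 0.

Definition surfS (n : nat) (F : 'I_n.+1 -> {mpoly K[3]}) : ('I_n.+1 -> K) -> Prop :=
  zclosure (image_pt F).

Definition psubset (m : nat) (X Y : ('I_m -> K) -> Prop) : Prop := forall v, X v -> Y v.
Definition pstrict (m : nat) (X Y : ('I_m -> K) -> Prop) : Prop :=
  psubset X Y /\ ~ psubset Y X.

Definition proj_irreducible (m : nat) (X : ('I_m -> K) -> Prop) : Prop :=
  proj_closed X /\ (exists v, X v) /\
  forall Y Z, proj_closed Y -> proj_closed Z -> (forall v, X v <-> (Y v \/ Z v)) ->
    psubset X Y \/ psubset X Z.

Definition irr_chain (m : nat) (X : ('I_m -> K) -> Prop) (l : nat) : Prop :=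
  exists Z : nat -> ('I_m -> K) -> Prop,
    (forall i, (i <= l)%N -> proj_irreducible (Z i)) /\
    (forall i, (i < l)%N -> pstrict (Z i) (Z i.+1)) /\ psubset (Z l) X.

Definition proj_dim (m : nat) (X : ('I_m -> K) -> Prop) (d : nat) : Prop :=
  irr_chain X d /\ ~ irr_chain X d.+1.

Definition jacobian_at (n : nat) (F : 'I_n.+1 -> {mpoly K[3]}) (u : 'I_3 -> K)
  : 'M[K]_(n.+1, 3) := \matrix_(i < n.+1, j < 3) ((F i)^`M(j)).@[u].

Definition cond_star (n : nat) (F : 'I_n.+1 -> {mpoly K[3]}) : Prop :=
  forall u, base_pt F u -> \rank (jacobian_at F u) = 2%N.

Definition cond_a (n : nat) (F : 'I_n.+1 -> {mpoly K[3]}) : Prop :=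
  forall u, base_pt F u -> forall j, u j != 0.

Definition e3 (j : 'I_3) : 'I_3 -> K := fun i => if i == j then 1 else 0.

Definition on_line (P Q R : 'I_3 -> K) : Prop :=
  exists l m : K, proj_eq (fun i => l * P i + m * Q i) R.

Definition cond_b (n : nat) (F : 'I_n.+1 -> {mpoly K[3]}) : Prop :=
  forall P Q, base_pt F P -> base_pt F Q -> ~ proj_eq P Q ->
    forall j, ~ on_line P Q (e3 j).

Definition upoly_at (q : {poly K}) (x : {mpoly K[3]}) : {mpoly K[3]} :=
  \sum_(j < size q) (q`_j)%:MP * x ^+ j.

(** Bivariate homogenization of degree d: q(a/b) b^d (requires size q <= d+1). *)
Definition homogen (q : {poly K}) (d : nat) (a b : {mpoly K[3]}) : {mpoly K[3]} :=
  \sum_(j < size q) (q`_j)%:MP * a ^+ j * b ^+ (d - j).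

Definition in_ideal (gs : seq {mpoly K[3]}) (p : {mpoly K[3]}) : Prop :=
  exists cs : seq {mpoly K[3]}, size cs = size gs /\
    p = \sum_(j < size gs) cs`_j * gs`_j.
Definition ideal_eq (gs hs : seq {mpoly K[3]}) : Prop :=
  (forall g, g \in gs -> in_ideal hs g) /\ (forall h, h \in hs -> in_ideal gs h).

Definition Fseq (n : nat) (F : 'I_n.+1 -> {mpoly K[3]}) : seq {mpoly K[3]} :=
  [seq F i | i <- enum 'I_n.+1].

(** The reduced lex (x0 < x1 < x2) Groebner basis of (F, x1 - 1) is
    {x2 - q1(x0), x1 - 1, p1(x0)} with deg p1 = k > deg q1.  For this shape
    this is equivalent to: p1 monic of degree k, deg q1 < k, and the two
    ideals coincide (leading terms x2, x1, x0^k are pairwise coprime). *)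
Definition gb_shape1 (n : nat) (F : 'I_n.+1 -> {mpoly K[3]}) (k : nat)
  (p1 q1 : {poly K}) : Prop :=
  p1 \is monic /\ size p1 = k.+1 /\ (size q1 <= k)%N /\
  ideal_eq (rcons (Fseq F) (X1 - 1))
           [:: X2 - upoly_at q1 X0; X1 - 1; upoly_at p1 X0].

Definition gb_shape2 (n : nat) (F : 'I_n.+1 -> {mpoly K[3]}) (k : nat)
  (p2 q2 : {poly K}) : Prop :=
  p2 \is monic /\ size p2 = k.+1 /\ (size q2 <= k)%N /\
  ideal_eq (rcons (Fseq F) (X2 - 1))
           [:: X2 - 1; X1 - upoly_at q2 X0; upoly_at p2 X0].

Definition Gtilde (n : nat) (F : 'I_n.+1 -> {mpoly K[3]}) (k : nat)
  (p1 q1 : {poly K}) : 'I_n.+1 -> {mpoly K[3]} :=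
  fun i => F i \mPo [tuple X0 * X1 ^+ k; X1 ^+ k.+1;
                     X1 ^+ 2 * homogen q1 k.-1 X0 X1 + X2 * homogen p1 k X0 X1].

Definition Htilde (n : nat) (F : 'I_n.+1 -> {mpoly K[3]}) (k : nat)
  (p2 q2 : {poly K}) : 'I_n.+1 -> {mpoly K[3]} :=
  fun i => F i \mPo [tuple X0 * X2 ^+ k;
                     X2 ^+ 2 * homogen q2 k.-1 X0 X2 + X1 * homogen p2 k X0 X2;
                     X2 ^+ k.+1].

(** G = Gt / gcd(Gt): G is coprime and Gt = g * G for a (nonzero) common
    factor g; this determines G up to a nonzero constant factor, which does
    not change the projective map. *)
Definition divided_by_gcd (n : nat) (Gt G : 'I_n.+1 -> {mpoly K[3]}) : Prop :=
  coprime_family G /\ exists g : {mpoly K[3]}, g != 0 /\ forall i, Gt i = g * G i.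

Definition chartF (n : nat) (F : 'I_n.+1 -> {mpoly K[3]}) (v : 'I_n.+1 -> K) : Prop :=
  exists s t : K, nonzero (evalmap F (pt3 1 s t)) /\ proj_eq v (evalmap F (pt3 1 s t)).
Definition chartG (n : nat) (G : 'I_n.+1 -> {mpoly K[3]}) (v : 'I_n.+1 -> K) : Prop :=
  exists s t : K, nonzero (evalmap G (pt3 s 1 t)) /\ proj_eq v (evalmap G (pt3 s 1 t)).
Definition chartH (n : nat) (H : 'I_n.+1 -> {mpoly K[3]}) (v : 'I_n.+1 -> K) : Prop :=
  exists s t : K, nonzero (evalmap H (pt3 s t 1)) /\ proj_eq v (evalmap H (pt3 s t 1)).

End Defs.

(* Main.v *)
Require Import Defs.
From HB Require Import structures.
From mathcomp Require Import all_boot all_order all_algebra.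
From mathcomp Require Import mpoly.
From mathcomp Require Import ring.
From Stdlib Require Import Classical.
Import Order.TTheory GRing.Theory Num.Theory.
Local Open Scope ring_scope.
Set Implicit Arguments. Unset Strict Implicit. Unset Printing Implicit Defensive.

(** A point v of S is a specialization F_i |-> v_i of K[F]; Chevalley's extension of
    places extends it to the ratios x_j / x_m for a suitable m, whose values give a
    point u of the plane such that every syzygy of F, evaluated at u, annihilates v.
    The Koszul syzygies show that v = F(u) if u is not a base point.  At a base point
    u, condition (star) makes the maximal ideal of u locally generated by the F_i, so
    there are enough syzygies to conclude that v lies in the column space of the
    Jacobian matrix at u, i.e. on the exceptional line over u.

    The substitution defining G is the affine chart (s, t) |-> (s : 1 : q1(s) + t p1(s))
    of the blow-up of the base locus.  If a is a root of p1, then x0 - a x1 divides the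
    common factor of the tuple, and differentiating in x0 at (a, 1, t) shows that G
    reaches the directions (1, 0, tau) at the corresponding base point.  The only
    missing direction (0, 0, 1) is reached by H, because by Euler's relation it is
    equivalent to (- u0 / u2, - u1 / u2, 0) and u0 is nonzero. *)

(** * Multivariate polynomials *)

(** Induction along algebra generators rather than monomials: it suits properties stable under
    products, such as the agreement of two ring morphisms. *)
Lemma mpoly_gen_ind (R : comNzRingType) (n : nat) (Q : {mpoly R[n]} -> Prop) :
  (forall c, Q c%:MP) -> (forall i, Q 'X_i) ->
  (forall p q, Q p -> Q q -> Q (p + q)) ->
  (forall p q, Q p -> Q q -> Q (p * q)) -> forall p, Q p.
Proof.
move=> QC QX QD QM; elim/mpolyind => [|c m p _ _ Qp]; first by rewrite -mpolyC0.
apply: (QD) => //; rewrite -mul_mpolyC; apply: (QM) => //.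
rewrite mpolyXE_id; elim/big_ind: _ => // [|i _]; first by rewrite -mpolyC1.
by elim: (m i) => [|k IH]; rewrite ?expr0 -?mpolyC1 // exprS; apply: QM.
Qed.

(** Otherwise [p + 1] takes only the value 1, so it has no root and must be constant, and then [p]
    is constant too. *)
Lemma infinite_poly0 (K : closedFieldType) (p : {poly K}) :
  (forall x, p.[x] = 0) -> p = 0.
Proof.
move=> p0; apply/eqP/negPn/negP => pn0.
have sz1 : size (p + 1) != 1%N \/ p = 0.
  case: (leqP (size p) 1) => [sp|sp]; last first.
    by left; rewrite size_polyDl ?size_poly1 // neq_ltn sp orbT.
  by right; rewrite (size1_polyC sp) -horner_coef0 p0.
case: sz1 => [|p0']; last by rewrite p0' eqxx in pn0.
move/closed_rootP => [x]; rewrite /root hornerD p0 hornerC add0r.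
by rewrite oner_eq0.
Qed.

(** Induction on the number of variables: [muni] views [p] as a univariate polynomial in the last
    variable, and [back], a left inverse of [muni], shows that nothing is lost. *)
Lemma infinite_mpoly0 (K : closedFieldType) (n : nat) (p : {mpoly K[n]}) :
  (forall v, p.@[v] = 0) -> p = 0.
Proof.
elim: n p => [|n IHn] p p0.
  suff [c pc] : exists c, p = c%:MP.
    by move: (p0 (fun=> 0)); rewrite pc mevalC => ->; rewrite mpolyC0.
  elim/mpoly_gen_ind: p {p0} => [c|[]|p q [c ->] [d ->]|p q [c ->] [d ->]] //.
  - by exists c.
  - by exists (c + d); rewrite mpolyCD.
  - by exists (c * d); rewrite mpolyCM.
pose back (r : {poly {mpoly K[n]}}) : {mpoly K[n.+1]} :=
  (map_poly (@mwiden n K) r).['X_ord_max].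
have muniXw i : muni ('X_i : {mpoly K[n.+1]}) =
   match unlift ord_max i with Some j => ('X_j)%:P | None => 'X end.
  rewrite /muni mmapX mmap1U; case: unliftP => [j ->|->].
    case: splitP => [k /= jk|k /= jk].
      congr (('X_ _)%:P); apply: val_inj; rewrite /= -jk /= /bump.
      by rewrite leqNgt ltn_ord.
    move: (ltn_ord j); rewrite /bump leqNgt ltn_ord /= add0n in jk.
    by rewrite jk ord1 addn0 ltnn.
  by case: splitP => // k /= jk; move: (ltn_ord k); rewrite -jk ltnn.
have backK q : back (muni q) = q.
  elim/mpoly_gen_ind: q => [c|i|q r IHq IHr|q r IHq IHr].
  - by rewrite muniC /back map_polyC hornerC /= mwidenC.
  - rewrite muniXw /back; case: unliftP => [j ->|->]; last by rewrite map_polyX hornerX.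
    rewrite map_polyC hornerC /= mwidenX mnmwiden1; congr 'X_[U_( _ )].
    by apply: val_inj; rewrite /= /bump leqNgt ltn_ord.
  - by rewrite muniD /back rmorphD hornerD; congr (_ + _).
  - by rewrite muniM /back rmorphM hornerM; congr (_ * _).
have ev q (w : 'I_n.+1 -> K) :
    (map_poly (meval (fun j => w (lift ord_max j))) (muni q)).[w ord_max] = q.@[w].
  elim/mpoly_gen_ind: q => [c|i|q r IHq IHr|q r IHq IHr].
  - by rewrite muniC map_polyC hornerC /= !mevalC.
  - rewrite muniXw mevalXU; case: unliftP => [j ->|->].
      by rewrite map_polyC hornerC /= mevalXU.
    by rewrite map_polyX hornerX.
  - by rewrite muniD mevalD rmorphD hornerD; congr (_ + _).
  - by rewrite muniM mevalM rmorphM hornerM; congr (_ * _).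
suff m0 : muni p = 0 by rewrite -(backK p) m0 /back rmorph0 horner0.
apply/polyP => k; rewrite coef0; apply: IHn => v.
suff : map_poly (meval v) (muni p) = 0.
  by move/polyP/(_ k); rewrite coef_map coef0.
apply: infinite_poly0 => x.
pose w i := match unlift ord_max i with Some j => v j | None => x end.
rewrite -[RHS](p0 w) -ev /w unlift_none; congr (_.[x]).
apply: eq_map_poly => q; apply: meval_eq => j.
by rewrite liftK.
Qed.

(** Stated for an arbitrary coefficient morphism so as to cover evaluation in the fraction field as
    well. *)
Lemma dhomog_mmap (R : nzRingType) (S : comNzRingType) (f : {rmorphism R -> S})
    (n d : nat) (p : {mpoly R[n]}) (c : S) (v w : 'I_n -> S) :
  p \is d.-homog -> (forall i, w i = c * v i) -> mmap f w p = c ^+ d * mmap f v p.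
Proof.
move=> /dhomogP hp hw; rewrite /mmap mulr_sumr.
rewrite big_seq [RHS]big_seq; apply: eq_bigr => m /hp hm.
rewrite mulrCA; congr (_ * _); rewrite /mmap1.
rewrite -hm /= mdegE -prodrXr -big_split /=.
by apply: eq_bigr => i _; rewrite hw exprMn.
Qed.

Lemma dhomog_eval (R : comNzRingType) (n d : nat) (p : {mpoly R[n]}) (c : R)
    (v w : 'I_n -> R) :
  p \is d.-homog -> (forall i, w i = c * v i) -> p.@[w] = c ^+ d * p.@[v].
Proof. exact: dhomog_mmap. Qed.

(** Congruence of [p] and its substitution modulo the ideal of the ['X_i - tnth lq i] is compatible
    with sums and products, so the generators suffice. *)
Lemma comp_mpoly_factor (R : comNzRingType) (n : nat) (lq : n.-tuple {mpoly R[n]})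
    (p : {mpoly R[n]}) :
  exists A : 'I_n -> {mpoly R[n]},
    p = p \mPo lq + \sum_i A i * ('X_i - tnth lq i).
Proof.
elim/mpoly_gen_ind: p => [c|i|p q [A hA] [B hB]|p q [A hA] [B hB]].
- exists (fun=> 0); rewrite comp_mpolyC big1 ?addr0 // => i _; exact: mul0r.
- exists (fun j => (j == i)%:R); rewrite comp_mpolyXU (bigD1 i) //= eqxx mul1r.
  rewrite big1 => [|j /negbTE ->]; last by rewrite mul0r.
  by rewrite addr0 -tnth_nth addrC subrK.
- exists (fun j => A j + B j); rewrite {1}hA {1}hB comp_mpolyD addrACA; congr (_ + _).
  by rewrite -big_split; apply: eq_bigr => i _; rewrite mulrDl.
- exists (fun j => A j * q + (p \mPo lq) * B j).
  under eq_bigr => i _ do rewrite mulrDl mulrAC -(mulrA (p \mPo lq)).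
  rewrite big_split /= -mulr_suml -mulr_sumr rmorphM /=.
  move: hA hB; set a := _ \mPo _; set b := _ \mPo _; set x := \sum_i _; set y := \sum_i _.
  move=> hA hB.
  rewrite {1}hA mulrDl; rewrite [in a * q]hB mulrDr.
  by rewrite -addrA [a * y + _]addrC.
Qed.

Lemma pihomogM_dhomog (R : comNzRingType) (n d e : nat) (p q : {mpoly R[n]}) :
  q \is d.-homog -> pihomog mdeg (e + d)%N (p * q) = pihomog mdeg e p * q.
Proof.
move=> hq; rewrite {1}(pihomog_partitionE (leqnn (mmeasure mdeg p))) mulr_suml linear_sum /=.
have [lt_e|le_e] := ltnP e (mmeasure mdeg p).
  rewrite (bigD1 (Ordinal lt_e)) //= pihomog_dE ?dhomogM ?pihomogP //.
  rewrite big1 ?addr0 // => i ne; apply: (pihomog_ne0 (d := (i + d)%N)).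
    by rewrite eqn_add2r; apply: contraNneq ne => ie; apply/eqP/val_inj.
  by apply: dhomogM => //; apply: pihomogP.
rewrite big1 => [|i _].
  rewrite [pihomog _ e p]big_seq_cond big_pred0 ?mul0r // => m.
  apply/negP => /andP[mp /eqP me].
  by move: (mmeasure_mnm_lt mdeg mp); rewrite me ltnNge le_e.
apply: (pihomog_ne0 (d := (i + d)%N)).
  by rewrite eqn_add2r ltn_eqF // (leq_trans (ltn_ord i)).
by apply: dhomogM => //; apply: pihomogP.
Qed.

(** The pullback of [p] along a polynomial curve [w]; its derivative is a directional derivative of
    [p]. *)
Definition peval (R : comNzRingType) (n : nat) (w : 'I_n -> {poly R}) (p : {mpoly R[n]}) :
  {poly R} := mmap (@polyC R) w p.

Lemma horner_peval (R : comNzRingType) (n : nat) (w : 'I_n -> {poly R})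
    (p : {mpoly R[n]}) (z : R) :
  (peval w p).[z] = p.@[fun i => (w i).[z]].
Proof.
rewrite /peval; elim/mpoly_gen_ind: p => [c|i|p q IHp IHq|p q IHp IHq].
- by rewrite mmapC mevalC /= hornerC.
- by rewrite mmapX mmap1U mevalXU.
- by rewrite mmapD mevalD hornerD; congr (_ + _).
- by rewrite rmorphM mevalM hornerM; congr (_ * _).
Qed.

Lemma deriv_peval (R : comNzRingType) (n : nat) (w : 'I_n -> {poly R}) (p : {mpoly R[n]}) :
  (peval w p)^`() = \sum_i peval w (p^`M(i)) * (w i)^`().
Proof.
rewrite /peval; elim/mpoly_gen_ind: p => [c|i|p q IHp IHq|p q IHp IHq].
- rewrite mmapC derivC big1 // => i _.
  by rewrite mderivC mmap0 mul0r.
- rewrite mmapX mmap1U (bigD1 i) //= mderivX mnm1E eqxx.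
  rewrite (_ : (U_(i) - U_(i))%MM = 0%MM); last by apply/mnmP => j; rewrite mnmBE mnm0E subnn.
  rewrite mpolyX0 scale1r rmorph1 mul1r big1 ?addr0 // => j ne.
  by rewrite mderivX mnm1E eq_sym (negPf ne) scale0r mmap0 mul0r.
- rewrite mmapD derivD IHp IHq -big_split; apply: eq_bigr => i _ /=.
  by rewrite mderivD mmapD mulrDl.
- rewrite rmorphM derivM /= IHp IHq mulr_suml mulr_sumr -big_split; apply: eq_bigr => i _ /=.
  by rewrite mderivM mmapD !rmorphM /= mulrDl mulrAC mulrA.
Qed.

Lemma dhomog_mderiv (R : nzRingType) (n d : nat) (p : {mpoly R[n]}) (j : 'I_n) :
  p \is d.-homog -> p^`M(j) \is (d.-1).-homog.
Proof.
move=> /dhomogP hp; apply/dhomogP => m; rewrite mcoeff_msupp mcoeff_mderiv => ne.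
have /hp <- : (m + U_(j))%MM \in msupp p.
  by rewrite mcoeff_msupp; apply: contraNneq ne => ->; rewrite mul0rn.
by rewrite /= mdegD mdeg1 addn1.
Qed.

(** * Extension of places *)

(** Euclidean division makes an element of least size a generator; the ideal being proper, a nonzero
    generator is not constant and has a root. *)
Lemma poly_ideal_root (K : closedFieldType) (I : {poly K} -> Prop) :
  (forall p q, I p -> I q -> I (p + q)) -> (forall p q, I q -> I (p * q)) ->
  ~ I 1 -> exists a, forall q, I q -> root q a.
Proof.
move=> ID IM I1.
case: (classic (exists q, I q /\ q != 0)) => [[q0 [Iq0 q0n0]]|noq]; last first.
  exists 0 => q Iq; suff -> : q = 0 by rewrite root0.
  by apply/eqP/negPn/negP => qn0; apply: noq; exists q.
have [g [Ig gn0 gdvd]] : exists g, [/\ I g, g != 0 & forall q, I q -> g %| q].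
  move: {2}(size q0) (leqnn (size q0)) => m.
  elim: m q0 Iq0 q0n0 => [|m IH] g Ig gn0 sg.
    by rewrite leqn0 size_poly_eq0 (negPf gn0) in sg.
  case: (classic (exists r, I r /\ ~~ (g %| r))) => [[r [Ir ndvd]]|nor].
    apply: (IH (r %% g)) => //.
    - have -> : r %% g = r + - (r %/ g) * g.
        by rewrite {2}(divp_eq r g) mulNr addrAC subrr add0r.
      by apply: ID => //; apply: IM.
    - by rewrite -ltnS (leq_trans _ sg) // ltn_modp.
  exists g; split=> // r Ir; apply/negPn/negP => nd; apply: nor.
  by exists r.
have /closed_rootP [a ga] : size g != 1%N.
  apply/negP => /size_poly1P [c cn0 gc]; apply: I1.
  by rewrite (_ : 1 = c^-1%:P * g); [apply: IM | rewrite gc -polyCM mulVf].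
by exists a => q /gdvd /divpK <-; rewrite rootM ga orbT.
Qed.

(* Graph of a K-algebra homomorphism to K defined on a K-subalgebra of L. *)
Record partial_place (K L : fieldType) (iota : K -> L) (P : L -> K -> Prop) : Prop :=
  PartialPlace {
    place_const : forall c, P (iota c) c;
    place_add : forall l c l' c', P l c -> P l' c' -> P (l + l') (c + c');
    place_mul : forall l c l' c', P l c -> P l' c' -> P (l * l') (c * c');
    place_zero : forall c, P 0 c -> c = 0 }.

Section Places.
Variables (K : closedFieldType) (L : fieldType) (iota : {rmorphism K -> L}).

Lemma place_sum P (pP : partial_place iota P) (I : Type) (r : seq I)
    (l : I -> L) (c : I -> K) :
  (forall i, P (l i) (c i)) -> P (\sum_(i <- r) l i) (\sum_(i <- r) c i).
Proof.
move=> h; elim: r => [|i r IH]; rewrite ?big_nil ?big_cons; last exact: (place_add pP).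
by have := place_const pP 0; rewrite rmorph0.
Qed.

Lemma place_opp P (pP : partial_place iota P) l c : P l c -> P (- l) (- c).
Proof.
move=> h; have := place_mul pP (place_const pP (-1)) h.
by rewrite rmorphN1 !mulN1r.
Qed.

Lemma place_sub P (pP : partial_place iota P) l c l' c' :
  P l c -> P l' c' -> P (l - l') (c - c').
Proof. by move=> h h'; apply: (place_add pP) => //; apply: place_opp. Qed.

Definition polys_related (P : L -> K -> Prop) (p : {poly L}) (q : {poly K}) :=
  forall j, P p`_j q`_j.

Lemma polys_relatedD P (pP : partial_place iota P) p q p' q' :
  polys_related P p q -> polys_related P p' q' -> polys_related P (p + p') (q + q').
Proof. by move=> h h' j; rewrite !coefD; apply: (place_add pP). Qed.

Lemma polys_relatedM P (pP : partial_place iota P) p q p' q' :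
  polys_related P p q -> polys_related P p' q' -> polys_related P (p * p') (q * q').
Proof.
move=> h h' j; rewrite !coefM; apply: (place_sum pP) => i.
exact: (place_mul pP).
Qed.

Lemma polys_relatedC P (pP : partial_place iota P) l c :
  P l c -> polys_related P l%:P c%:P.
Proof.
move=> h j; rewrite !coefC; case: eqP => // _.
by have := place_const pP 0; rewrite rmorph0.
Qed.

Lemma polys_relatedX P (pP : partial_place iota P) : polys_related P 'X 'X.
Proof.
move=> j; rewrite !coefX; have := place_const pP (j == 1%N)%:R.
by rewrite rmorph_nat.
Qed.

Definition adjoin (P : L -> K -> Prop) (z : L) (a : K) : L -> K -> Prop :=
  fun l c => exists p q, [/\ polys_related P p q, l = p.[z] & c = q.[a]].

(** The reductions of the polynomials over the domain of [P] that vanish at [z] form an ideal of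
    [{poly K}], proper by hypothesis. Sending [z] to a common root of it is consistent. *)
Lemma adjoin_place P (pP : partial_place iota P) z :
  (forall p, p.[z] = 0 -> ~ polys_related P p 1) ->
  exists a, [/\ partial_place iota (adjoin P z a),
    forall l c, P l c -> adjoin P z a l c & adjoin P z a z a].
Proof.
move=> nounit.
pose I q := exists p, polys_related P p q /\ p.[z] = 0.
have [a Ia] : exists a, forall q, I q -> root q a.
  apply: poly_ideal_root.
  - move=> q q' [p [h pz]] [p' [h' p'z]]; exists (p + p').
    by rewrite hornerD pz p'z addr0; split=> //; apply: polys_relatedD.
  - move=> r q [p [h pz]]; exists (map_poly iota r * p).
    rewrite hornerM pz mulr0; split=> //; apply: polys_relatedM => // j.
    by rewrite coef_map; apply: (place_const pP).
  - by move=> [p [h pz]]; apply: (nounit p).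
exists a; split.
- split.
  + move=> c; exists (iota c)%:P, c%:P; split; rewrite ?hornerC //.
    exact/(polys_relatedC pP)/(place_const pP).
  + move=> l c l' c' [p [q [h -> ->]]] [p' [q' [h' -> ->]]].
    by exists (p + p'), (q + q'); rewrite !hornerD; split=> //; apply: polys_relatedD.
  + move=> l c l' c' [p [q [h -> ->]]] [p' [q' [h' -> ->]]].
    by exists (p * p'), (q * q'); rewrite !hornerM; split=> //; apply: polys_relatedM.
  + move=> c [p [q [h pz ->]]]; apply/eqP; apply: Ia; exists p; split=> //.
- move=> l c h; exists l%:P, c%:P; rewrite !hornerC; split=> //.
  exact: polys_relatedC.
- exists 'X, 'X; rewrite !hornerX; split=> //; exact: polys_relatedX.
Qed.

(* Two equations for z, with coefficients specializing to the constant 1 and to the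
   top monomial, are incompatible: subtract multiples of each other to lower degrees. *)
Lemma no_two_unit_equations P (pP : partial_place iota P) z (zn0 : z != 0)
    (m r : nat) (p q : {poly L}) :
  (size p <= m.+1)%N -> (size q <= r.+1)%N -> p.[z] = 0 -> q.[z] = 0 ->
  polys_related P p 1 -> polys_related P q 'X^r -> False.
Proof.
move: {2}(m + r)%N (leqnn (m + r)) => s.
elim: s m r p q => [|s IH] m r p q le_s sp sq pz qz hp hq.
all: have m0 : (0 < m)%N by
  (rewrite lt0n; apply/eqP => m0; subst m; move: (hp 0%N);
   rewrite (size1_polyC sp) coefC /= -[p`_0](hornerC _ z) -size1_polyC // pz coef1 /=;
   move/(place_zero pP)/eqP; rewrite oner_eq0).
  by rewrite leqn0 addn_eq0 (gtn_eqF m0) in le_s.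
case: (leqP r m) => [rm|mr].
(* The terms of degree [m] cancel. The reduction of the new polynomial is still 1, because the
   coefficient of degree [r] in [q] reduces to 1 and that of degree [m] in [p] to 0, [m] being
   positive. *)
- apply: (IH m.-1 r (q`_r *: p - p`_m *: 'X^(m - r) * q) q) => //.
  + by rewrite -ltnS -addSn prednK.
  + rewrite prednK //; apply/leq_sizeP => j mj.
    rewrite coefB -scalerAl !coefZ coefXnM ltnNge (leq_trans (leq_subr _ _) mj) /=.
    move: mj; rewrite leq_eqVlt => /orP[/eqP <-|mj]; first by rewrite subKn // mulrC subrr.
    rewrite (nth_default _ (leq_trans sp mj)) mulr0 (nth_default 0 (leq_trans sq _)) ?mulr0 ?subr0 //.
    by rewrite ltn_subRL subnK.
  + by rewrite hornerD hornerN -scalerAl !hornerZ hornerM pz qz !mulr0 subr0.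
  + have -> : 1 = 1%:P * 1 - 0%:P * ('X^(m - r) * 'X^r) :> {poly K}.
      by rewrite polyC0 mul0r subr0 mul1r.
    rewrite -scalerAl -!mul_polyC => j; rewrite !coefB; apply: (place_sub pP).
      apply: (polys_relatedM pP) => //; apply: (polys_relatedC pP).
      by have := hq r; rewrite coefXn eqxx.
    apply: (polys_relatedM pP); first apply: (polys_relatedC pP).
      by have := hp m; rewrite coef1 gtn_eqF.
    apply: (polys_relatedM pP) => // i; rewrite !coefXn.
    by have := place_const pP (i == (m - r)%N)%:R; rewrite rmorph_nat.
(* The constant terms cancel, and as [z] is nonzero a factor ['X] can be removed from the equation,
   which lowers [r] by one. *)
- pose t := p`_0 *: q - q`_0 *: p.
  have tX : t = drop_poly 1 t * 'X.
    rewrite -{1}(poly_take_drop 1 t) expr1 (_ : take_poly 1 t = 0) ?add0r //.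
    apply/polyP => j; rewrite coef_take_poly coef0; case: j => //=.
    by rewrite coefB !coefZ mulrC subrr.
  apply: (IH m r.-1 p (drop_poly 1 t)) => //.
  + by rewrite -ltnS -addnS prednK // (leq_ltn_trans _ mr).
  + rewrite prednK ?(leq_ltn_trans _ mr) // size_drop_poly leq_subLR add1n.
    rewrite (leq_trans (size_polyD _ _)) // size_polyN geq_max.
    rewrite (leq_trans (size_scale_leq _ _)) // (leq_trans (size_scale_leq _ _)) //.
    by rewrite (leq_trans sp) // ltnW.
  + have : t.[z] = 0 by rewrite hornerD hornerN !hornerZ pz qz !mulr0 subr0.
    by rewrite {1}tX hornerMX => /eqP; rewrite mulf_eq0 (negPf zn0) orbF => /eqP.
  + move=> j; rewrite coef_drop_poly coefB !coefZ.
    have -> : ('X^(r.-1))`_j = 1 * ('X^r)`_(j + 1) - 0 * (1 : {poly K})`_(j + 1) :> K.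
      by rewrite mul1r mul0r subr0 !coefXn addn1 -eqSS prednK // (leq_ltn_trans _ mr).
    apply: (place_sub pP); apply: (place_mul pP) => //.
      by have := hp 0%N; rewrite coef1.
    by have := hq 0%N; rewrite coefXn ltn_eqF // (leq_ltn_trans _ mr).
Qed.

(* Chevalley's extension step for valuation rings *)
Lemma place_extend P (pP : partial_place iota P) z : z != 0 ->
  exists P' a, [/\ partial_place iota P', forall l c, P l c -> P' l c &
                P' z a \/ P' z^-1 a].
Proof.
move=> zn0.
case: (classic (exists p, p.[z] = 0 /\ polys_related P p 1)) => [[p [pz hp]]|no].
  case: (classic (exists p, p.[z^-1] = 0 /\ polys_related P p 1)) => [[q [qz hq]]|no].
    exfalso; pose r := (size q).-1.
    (* Reversing the coefficients amounts to multiplying by [z ^+ r]: the equation for the inverse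
       of [z] becomes one for [z], and the constant 1 becomes the monomial of degree [r]. *)
    pose q' := \poly_(j < r.+1) q`_(r - j).
    apply: (@no_two_unit_equations P pP z zn0 (size p) r p q') => //.
    - exact: size_poly.
    - rewrite horner_poly.
      have -> : \sum_(i < r.+1) q`_(r - i) * z ^+ i = z ^+ r * q.[z^-1].
        rewrite (@horner_coef_wide _ r.+1); last by rewrite /r; case: (size q).
        rewrite (reindex_inj rev_ord_inj) mulr_sumr; apply: eq_bigr => i _ /=.
        rewrite subSS subKn -1?ltnS // exprVn mulrCA -exprB ?unitfE //.
        by rewrite -ltnS.
      by rewrite qz mulr0.
    - move=> j; rewrite coef_poly coefXn; case: ltnP => jr.
        by have := hq (r - j)%N; rewrite coef1 subn_eq0 eqn_leq (_ : (j <= r)%N).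
      have := place_const pP 0; rewrite rmorph0 gtn_eqF //.
  have [a [h1 h2 h3]] := @adjoin_place P pP z^-1 (fun p pz h => no (ex_intro _ p (conj pz h))).
  by exists (adjoin P z^-1 a), a; split=> //; right.
have [a [h1 h2 h3]] := @adjoin_place P pP z (fun p pz h => no (ex_intro _ p (conj pz h))).
by exists (adjoin P z a), a; split=> //; left.
Qed.
End Places.

(** * Limit points and syzygies *)

Section Closure.
Variables (K : closedFieldType) (n d : nat) (F : 'I_n.+1 -> {mpoly K[3]}).
Hypothesis Fhom : forall i, F i \is d.-homog.

Lemma coprime_nonzero (G : 'I_n.+1 -> {mpoly K[3]}) :
  coprime_family G -> exists i, G i != 0.
Proof.
move=> coG; apply: NNPP => noG.
have [|c [cn0 /esym/eqP]] := coG 0.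
  move=> i; exists 0; rewrite mulr0; apply/eqP/negPn/negP => Gi.
  by apply: noG; exists i.
by rewrite mpolyC_eq0 (negPf cn0).
Qed.

Lemma image_pt_eval u : nonzero u -> nonzero (evalmap F u) -> image_pt F (evalmap F u).
Proof.
move=> un0 [i Fi]; exists u; split=> //; split=> // -[_ /(_ i)/eqP].
by rewrite (negPf Fi).
Qed.

(** The closure is tested on homogeneous polynomials only, so each component of [p] has to vanish on
    the image. It does because [z * F(u)] equals [F(c * u)] for a [d]-th root [c] of [z], so that
    [p] vanishes on the whole line through [F(u)]. *)
Lemma surf_relation (v : 'I_n.+1 -> K) (p : {mpoly K[n.+1]}) :
  (0 < d)%N -> surfS F v -> p \mPo [tuple F i | i < n.+1] = 0 -> p.@[v] = 0.
Proof.
move=> d_gt0 [_ vS] pF0.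
have pF u : p.@[evalmap F u] = 0.
  rewrite -[RHS](meval0 u) -pF0 comp_mpoly_meval; apply: meval_eq => i.
  by rewrite tnth_mktuple.
pose k := mmeasure mdeg p.
rewrite (pihomog_partitionE (leqnn k)) raddf_sum big1 //= => e _.
apply: vS => [|w [u [un0 [nb wE]]]]; first by exists e; apply: pihomogP.
pose q := \poly_(j < k) (pihomog mdeg j p).@[w].
suff q0 : q = 0.
  by have := coef_poly k (fun j => (pihomog mdeg j p).@[w]) e; rewrite -/q q0 coef0 ltn_ord.
apply: infinite_poly0 => z.
have /closed_rootP [c] : size ('X^d - z%:P) != 1%N by rewrite size_XnsubC // eqSS -lt0n.
rewrite /root !hornerE subr_eq0 => /eqP cz.
rewrite -[RHS](pF (fun j => c * u j)) horner_poly.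
rewrite {2}(pihomog_partitionE (leqnn k)) raddf_sum; apply: eq_bigr => j _ /=.
rewrite mulrC; symmetry; apply: (dhomog_eval (pihomogP _ _ _)) => i.
by rewrite wE -cz /evalmap; apply: dhomog_eval.
Qed.

(** The place [P0] sending [F i] to [v i] is well defined by [surf_relation]. After extension to the
    ratios [x j / x m], it is applied to the syzygy divided by a power of [x m]. *)
Lemma surf_syzygy_hom (v : 'I_n.+1 -> K) : (0 < d)%N -> surfS F v ->
  exists u, nonzero u /\ forall e (b : 'I_n.+1 -> {mpoly K[3]}),
    (forall i, b i \is e.-homog) -> \sum_i b i * F i = 0 -> \sum_i (b i).@[u] * v i = 0.
Proof.
move=> d_gt0 vS.
pose L := {fraction {mpoly K[3]}}.
pose iota : {rmorphism K -> L} := (@tofrac {mpoly K[3]}) \o (@mpolyC 3 K).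
pose P0 (l : L) c := exists p : {mpoly K[n.+1]},
  l = tofrac (p \mPo [tuple F i | i < n.+1]) /\ c = p.@[v].
have pP0 : partial_place iota P0.
  split.
  - by move=> c; exists c%:MP; rewrite comp_mpolyC mevalC.
  - move=> l c l' c' [p [-> ->]] [p' [-> ->]]; exists (p + p').
    by rewrite comp_mpolyD tofracD mevalD.
  - move=> l c l' c' [p [-> ->]] [p' [-> ->]]; exists (p * p').
    by rewrite rmorphM tofracM mevalM.
  - move=> c [p [/esym/eqP]]; rewrite tofrac_eq0 => /eqP pF ->.
    exact: surf_relation.
pose x (j : 'I_3) : L := tofrac 'X_j.
have xn0 j : x j != 0.
  rewrite tofrac_eq0; apply/eqP => X0; have := mevalXU (fun=> 1 : K) j.
  by rewrite X0 meval0 => /esym/eqP; rewrite oner_eq0.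
have xdiv j k l : x j / x l = (x j / x k) * (x k / x l) by rewrite mulrA divfK.
pose o0 : 'I_3 := @Ordinal 3 0 isT; pose o1 : 'I_3 := @Ordinal 3 1 isT.
pose o2 : 'I_3 := @Ordinal 3 2 isT.
(* Extend to [x o1 / x o0] or its inverse, then compare [x o2] with the denominator obtained. If
   [x o2] replaces it as denominator, the missing ratio is a product of two known ones. *)
have [P [m [u [pP P0P um Pu]]]] : exists P m u,
    [/\ partial_place iota P, forall l c, P0 l c -> P l c, u m = 1 &
     forall j, P (x j / x m) (u j)].
  have one P : partial_place iota P -> forall j, P (x j / x j) 1.
    by move=> pP j; rewrite divff //; have := place_const pP 1; rewrite rmorph1.
  have I3 (Q : 'I_3 -> Prop) : Q o0 -> Q o1 -> Q o2 -> forall j, Q j.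
    by move=> q0 q1 q2 [[|[|[|//]]] lt]; rewrite (bool_irrelevance lt isT).
  have [P1 [a1 [pP1 P01 [h1|h1]]]] :=
    place_extend pP0 (mulf_neq0 (xn0 o1) (invr_neq0 (xn0 o0))).
    have [P2 [a2 [pP2 P12 [h2|h2]]]] :=
      place_extend pP1 (mulf_neq0 (xn0 o2) (invr_neq0 (xn0 o0))).
      exists P2, o0, (pt3 1 a1 a2); split=> //; first by move=> l c /P01/P12.
      by apply: I3 => //=; [exact: (one _ pP2) | exact: P12].
    exists P2, o2, (pt3 a2 (a1 * a2) 1); split=> //; first by move=> l c /P01/P12.
    rewrite invf_div in h2; apply: I3 => //=; last exact: (one _ pP2).
    by rewrite (xdiv _ o0); exact: (place_mul pP2 (P12 _ _ h1) h2).
  rewrite invf_div in h1.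
  have [P2 [a2 [pP2 P12 [h2|h2]]]] :=
      place_extend pP1 (mulf_neq0 (xn0 o2) (invr_neq0 (xn0 o1))).
    exists P2, o1, (pt3 a1 1 a2); split=> //; first by move=> l c /P01/P12.
    by apply: I3 => //=; [exact: P12 | exact: (one _ pP2)].
  exists P2, o2, (pt3 (a1 * a2) a2 1); split=> //; first by move=> l c /P01/P12.
  rewrite invf_div in h2; apply: I3 => //=; last exact: (one _ pP2).
  by rewrite (xdiv _ o1); exact: (place_mul pP2 (P12 _ _ h1) h2).
exists u; split; first by exists m; rewrite um oner_neq0.
move=> e b bh bF.
pose z j := x j / x m.
have Pb (p : {mpoly K[3]}) : P (mmap iota z p) p.@[u].
  elim/mpoly_gen_ind: p => [c|i|p q IHp IHq|p q IHp IHq].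
  - by rewrite mmapC mevalC; apply: (place_const pP).
  - by rewrite mmapX mmap1U mevalXU; apply: Pu.
  - by rewrite mmapD mevalD; apply: (place_add pP).
  - by rewrite rmorphM mevalM; apply: (place_mul pP).
have xE (p : {mpoly K[3]}) : mmap iota x p = tofrac p.
  elim/mpoly_gen_ind: p => [c|i|p q IHp IHq|p q IHp IHq].
  - by rewrite mmapC.
  - by rewrite mmapX mmap1U.
  - by rewrite mmapD tofracD; congr (_ + _).
  - by rewrite rmorphM tofracM; congr (_ * _).
have bz i : mmap iota z (b i) = tofrac (b i) / x m ^+ e.
  apply/(canRL (mulfK (expf_neq0 e (xn0 m)))); rewrite mulrC -xE; symmetry.
  by apply: dhomog_mmap => // j; rewrite mulrC divfK.
apply: (place_zero pP).
rewrite [X in P X](_ : 0 = \sum_i mmap iota z (b i) * tofrac (F i)).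
  apply: (place_sum pP) => i; apply: (place_mul pP) => //; apply: P0P.
  by exists 'X_i; rewrite comp_mpolyXU mevalXU -tnth_nth tnth_mktuple.
transitivity (tofrac (\sum_i b i * F i) / x m ^+ e); first by rewrite bF tofrac0 mul0r.
rewrite rmorph_sum mulr_suml; apply: eq_bigr => i _ /=.
by rewrite bz tofracM mulrAC.
Qed.

(** In degree 0 the [F i] are constants, and an evaluated syzygy is a linear equation of the image,
    hence of its closure. In positive degree the homogeneous components of a syzygy are syzygies,
    because the [F i] share one degree. *)
Lemma surf_syzygy (v : 'I_n.+1 -> K) : surfS F v ->
  exists u, nonzero u /\ forall b : 'I_n.+1 -> {mpoly K[3]},
    \sum_i b i * F i = 0 -> \sum_i (b i).@[u] * v i = 0.
Proof.
move=> vS; have [d0|d_gt0] := posnP d.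
  exists (fun=> 1); split=> [|b bF]; first by exists ord0; rewrite oner_neq0.
  pose p : {mpoly K[n.+1]} := \sum_i (b i).@[fun=> 1] *: 'X_i.
  have pE w : p.@[w] = \sum_i (b i).@[fun=> 1] * w i.
    by rewrite raddf_sum; apply: eq_bigr => i _ /=; rewrite mevalZ mevalXU.
  rewrite -pE; apply: (proj2 vS) => [|w [u [_ [_ wE]]]].
    exists 1%N; apply: rpred_sum => i _; apply: rpredZ.
    by rewrite dhomogX; apply/eqP; exact: mdeg1.
  rewrite pE -[RHS](meval0 (fun _ : 'I_3 => 1 : K)) -bF raddf_sum; apply: eq_bigr => i _ /=.
  rewrite mevalM wE; congr (_ * _).
  have F0 w' : (F i).@[w'] = (F i).@[fun=> 0].
    have := Fhom i; rewrite d0 => hom0.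
    by rewrite (@dhomog_eval _ _ _ _ 0 w' (fun=> 0) hom0) ?expr0 ?mul1r // => j; rewrite mul0r.
  by rewrite !F0.
have [u [un0 hu]] := surf_syzygy_hom d_gt0 vS.
exists u; split=> // b bF.
pose k := \max_i mmeasure mdeg (b i).
have bE i : b i = \sum_(e < k) pihomog mdeg e (b i).
  by apply: pihomog_partitionE; apply: leq_bigmax.
under eq_bigr => i _ do rewrite bE raddf_sum mulr_suml /=.
rewrite exchange_big big1 //= => e _; apply: (hu e) => [i|]; first exact: pihomogP.
transitivity (pihomog mdeg (e + d)%N (\sum_i b i * F i)); last by rewrite bF linear0.
by rewrite linear_sum; apply: eq_bigr => i _ /=; rewrite pihomogM_dhomog.
Qed.

(** A homogeneous [p] of degree [e] vanishing on the image satisfies [p(F) = 0], hence [p(Gt) = 0]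
    by substitution. As [p(Gt) = g ^+ e * p(G)], also [p(G) = 0]. *)
Lemma chart_in_surf (G Gt : 'I_n.+1 -> {mpoly K[3]}) g
    (Phi : ('I_3 -> K) -> 'I_3 -> K) u v :
  coprime_family F -> (forall w i, (Gt i).@[w] = (F i).@[Phi w]) ->
  g != 0 -> (forall i, Gt i = g * G i) ->
  nonzero v -> proj_eq v (evalmap G u) -> surfS F v.
Proof.
move=> coF GtF gn0 GtG vn0 [_ [c [_ vE]]]; split=> // p [e ph] pS.
have [i0 Fi0] := coprime_nonzero coF.
have pF : p \mPo [tuple F i | i < n.+1] = 0.
  (* The two extra factors vanish at the zero vector and at the base points, where the hypothesis on
     [p] says nothing. *)
  apply/eqP; have : 'X_ord0 * F i0 * (p \mPo [tuple F i | i < n.+1]) == 0.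
    apply/eqP/infinite_mpoly0 => w; rewrite !mevalM mevalXU comp_mpoly_meval.
    have [->|w0] := eqVneq (w ord0) 0; first by rewrite !mul0r.
    have [->|Fw] := eqVneq (F i0).@[w] 0; first by rewrite mulr0 mul0r.
    rewrite (_ : p.@[_] = 0) ?mulr0 // (meval_eq (v2 := evalmap F w)) => [|i].
      by apply/pS/image_pt_eval; [exists ord0 | exists i0].
    by rewrite tnth_mktuple.
  rewrite !mulf_eq0 (negPf Fi0) orbF => /orP[/eqP X0|//].
  have := mevalXU (fun=> 1 : K) (ord0 : 'I_3).
  by rewrite X0 meval0 => /esym/eqP; rewrite oner_eq0.
have pG : p \mPo [tuple G i | i < n.+1] = 0.
  apply/eqP; have : g ^+ e * (p \mPo [tuple G i | i < n.+1]) == 0.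
    apply/eqP/infinite_mpoly0 => w; rewrite mevalM rmorphXn /= -[RHS](meval0 (Phi w)) -pF.
    rewrite !comp_mpoly_meval; symmetry; apply: dhomog_eval => // i.
    by rewrite !tnth_mktuple -GtF GtG mevalM.
  by rewrite mulf_eq0 expf_eq0 (negPf gn0) andbF.
rewrite (dhomog_eval ph vE) (_ : p.@[_] = 0) ?mulr0 //.
rewrite -[RHS](meval0 u) -pG comp_mpoly_meval; apply: meval_eq => i.
by rewrite tnth_mktuple.
Qed.
End Closure.

(** * Charts of the blow-up *)

Section Charts.
Variables (K : closedFieldType) (n d : nat) (F : 'I_n.+1 -> {mpoly K[3]}).
Hypothesis Fhom : forall i, F i \is d.-homog.
Variables (o m l : 'I_3).
Hypotheses (mo : m != o) (lo : l != o) (lm : l != m).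

Lemma ord3_cases j : [|| j == o, j == m | j == l].
Proof.
by move: mo lo lm; case: o m l j => [[|[|[|//]]] ?] [[|[|[|//]]] ?] [[|[|[|//]]] ?] [[|[|[|//]]] ?].
Qed.

Definition ptm (T : Type) (a b c : T) : 'I_3 -> T :=
  fun j => if j == o then a else if j == m then b else c.

Lemma ptm_o T (a b c : T) : ptm a b c o = a. Proof. by rewrite /ptm eqxx. Qed.
Lemma ptm_m T (a b c : T) : ptm a b c m = b.
Proof. by rewrite /ptm (negPf mo) eqxx. Qed.
Lemma ptm_l T (a b c : T) : ptm a b c l = c.
Proof. by rewrite /ptm (negPf lo) (negPf lm). Qed.
Definition ptmE := (ptm_o, ptm_m, ptm_l).

Lemma sum_ord3 (V : nmodType) (f : 'I_3 -> V) : \sum_j f j = f o + f m + f l.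
Proof.
rewrite (bigD1 o) //= (bigD1 m) //= (bigD1 l) ?lo ?lm //= big1 ?addr0 ?addrA // => j.
by case/andP=> [/andP[jo jm] jl]; have := ord3_cases j; rewrite (negPf jo) (negPf jm) (negPf jl).
Qed.

Lemma peval_ptm_horner (a b c : {poly K}) (p : {mpoly K[3]}) z :
  (peval (ptm a b c) p).[z] = p.@[ptm a.[z] b.[z] c.[z]].
Proof.
rewrite horner_peval; apply: meval_eq => j.
by case/or3P: (ord3_cases j) => /eqP ->; rewrite !ptmE.
Qed.

Lemma deriv_peval_ptm (a c : {poly K}) (p : {mpoly K[3]}) z :
  (peval (ptm a 1 c) p)^`().[z] =
  (p^`M(o)).@[ptm a.[z] 1 c.[z]] * a^`().[z] + (p^`M(l)).@[ptm a.[z] 1 c.[z]] * c^`().[z].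
Proof.
rewrite deriv_peval sum_ord3 !hornerE !ptmE !peval_ptm_horner hornerC.
by rewrite (derivC 1) horner0 mulr0 addr0.
Qed.

(** [F i] vanishes on the line spanned by [u]; differentiate its pullback along [z |-> z * u] at
    [z = 1]. *)
Lemma euler_base u : base_pt F u -> forall i, \sum_j ((F i)^`M(j)).@[u] * u j = 0.
Proof.
move=> [_ Fu] i.
have F0 : peval (fun j => (u j) *: 'X) (F i) = 0.
  apply: infinite_poly0 => z; rewrite horner_peval.
  rewrite (@dhomog_eval _ _ _ _ z u _ (Fhom i)) ?Fu ?mulr0 // => j.
  by rewrite hornerZ hornerX mulrC.
have := deriv_peval (fun j => (u j) *: 'X) (F i).
rewrite F0 deriv0 => /(congr1 (fun p => p.[1])); rewrite horner0 horner_sum => {2}->.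
apply: eq_bigr => j _; rewrite hornerM derivZ derivX horner_peval hornerZ hornerC mulr1.
by congr (_ * _); apply: meval_eq => k; rewrite hornerZ hornerX mulr1.
Qed.

(** Euler's relation expresses column [m] of the Jacobian through columns [o] and [l], so rank 2
    makes these two independent. The rows of a left inverse are [c1] and [c2]. *)
Lemma base_partials_dual u : cond_star F -> base_pt F u -> u m != 0 ->
  exists c1 c2 : 'I_n.+1 -> K,
    [/\ \sum_i c1 i * ((F i)^`M(o)).@[u] = 1, \sum_i c1 i * ((F i)^`M(l)).@[u] = 0,
        \sum_i c2 i * ((F i)^`M(o)).@[u] = 0 & \sum_i c2 i * ((F i)^`M(l)).@[u] = 1].
Proof.
move=> star bu um.
pose M : 'M[K]_(n.+1, 2) := \matrix_(i, j) ((F i)^`M(if j == 0 then o else l)).@[u].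
pose Z : 'M[K]_(2, 3) := \matrix_(j, k)
  if j == 0 then ptm 1 (- (u o / u m)) 0 k else ptm 0 (- (u l / u m)) 1 k.
have JE : jacobian_at F u = M *m Z.
  apply/matrixP => i k; rewrite !mxE big_ord_recl big_ord1 !mxE /=.
  case/or3P: (ord3_cases k) => /eqP ->; rewrite !ptmE ?mulr0 ?mulr1 ?addr0 ?add0r //.
  have := euler_base bu i; rewrite sum_ord3 addrAC => /eqP.
  by rewrite addrC addr_eq0 => /eqP /(canRL (mulfK um)) ->; ring.
have /row_fullP [B BM] : row_full M.
  by rewrite -col_leq_rank (leq_trans _ (mxrankM_maxl M Z)) // -JE (star u bu).
have E (j j' : 'I_2) : \sum_i B j i * ((F i)^`M(if j' == 0 then o else l)).@[u] = (j == j')%:R.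
  move/matrixP/(_ j j'): BM; rewrite !mxE => <-.
  by apply: eq_bigr => i _; rewrite mxE.
exists (B 0), (B 1); split.
- by have := E 0 0.
- by have := E 0 1.
- by have := E 1 0.
- by have := E 1 1.
Qed.

(** Substituting [(u j / u m) *: 'X_m] for each variable turns [F i] into a multiple of its value at
    [u], which is 0. The product rule then identifies the cofactors at [u]. *)
Lemma base_factor u : base_pt F u -> u m != 0 -> forall i,
  exists A B : {mpoly K[3]},
  [/\ F i = A * ('X_o - (u o / u m) *: 'X_m) + B * ('X_l - (u l / u m) *: 'X_m),
      A.@[u] = ((F i)^`M(o)).@[u] & B.@[u] = ((F i)^`M(l)).@[u]].
Proof.
move=> [_ Fu] um i.
pose lq : 3.-tuple {mpoly K[3]} := [tuple (u j / u m) *: 'X_m | j < 3].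
have [A AE] := comp_mpoly_factor lq (F i).
have F0 : F i \mPo lq = 0.
  apply: infinite_mpoly0 => w; rewrite comp_mpoly_meval.
  rewrite (@dhomog_eval _ _ _ _ (w m / u m) u _ (Fhom i)) ?Fu ?mulr0 // => j.
  by rewrite tnth_mktuple mevalZ mevalXU mulrAC [RHS]mulrC mulrA.
exists (A o), (A l).
have FE : F i = A o * ('X_o - (u o / u m) *: 'X_m) + A l * ('X_l - (u l / u m) *: 'X_m).
  rewrite {1}AE F0 add0r sum_ord3 !tnth_mktuple divff // scale1r.
  by rewrite subrr mulr0 addr0.
have lin0 j : ('X_j - (u j / u m) *: 'X_m : {mpoly K[3]}).@[u] = 0.
  by rewrite mevalB mevalZ !mevalXU divfK // subrr.
have dlin j k : k != m -> (('X_j - (u j / u m) *: 'X_m : {mpoly K[3]})^`M(k)).@[u] = (j == k)%:R.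
  move=> km; rewrite mderivB mderivZ !mderivX !mnm1E eq_sym [m == k]eq_sym (negPf km) scale0r scaler0 subr0.
  case: eqVneq => [->|_]; last by rewrite scale0r meval0.
  rewrite (_ : (U_(j) - U_(j))%MM = 0%MM); last by apply/mnmP => j'; rewrite mnmBE mnm0E subnn.
  by rewrite mpolyX0 scale1r meval1.
have om : o != m by rewrite eq_sym.
have ol : o != l by rewrite eq_sym.
split=> //; rewrite FE mderivD !mderivM !mevalD !mevalM !lin0 !dlin //.
  by rewrite eqxx (negPf lo) !mulr0 !add0r addr0 mulr1.
by rewrite eqxx (negPf ol) !mulr0 !add0r mulr1.
Qed.

(* Near a base point the two linear forms vanishing there are, up to a unit, combinations
   of the F_i, so every F_i - (its linear part in terms of these) yields a syzygy. *)
Lemma base_exceptional u v : cond_star F -> base_pt F u -> u m != 0 ->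
  (forall b : 'I_n.+1 -> {mpoly K[3]},
    \sum_i b i * F i = 0 -> \sum_i (b i).@[u] * v i = 0) ->
  exists al be : K, forall i, v i = al * ((F i)^`M(o)).@[u] + be * ((F i)^`M(l)).@[u].
Proof.
move=> star bu um syz.
have [c1 [c2 [c1o c1l c2o c2l]]] := base_partials_dual star bu um.
set xo := 'X_o - (u o / u m) *: 'X_m : {mpoly K[3]}.
set xl := 'X_l - (u l / u m) *: 'X_m : {mpoly K[3]}.
have lin (c : 'I_n.+1 -> K) : exists A B : {mpoly K[3]},
  [/\ \sum_i (c i)%:MP * F i = A * xo + B * xl,
     A.@[u] = \sum_i c i * ((F i)^`M(o)).@[u] & B.@[u] = \sum_i c i * ((F i)^`M(l)).@[u]].
  elim: (index_enum _) => [|i r [A [B [E Au Bu]]]].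
    by exists 0, 0; rewrite !big_nil !mul0r addr0 meval0.
  have [A' [B' [E' A'u B'u]]] := base_factor bu um i.
  exists ((c i)%:MP * A' + A), ((c i)%:MP * B' + B).
  rewrite !big_cons !mevalD !mevalM !mevalC Au Bu A'u B'u; split=> //.
  by rewrite E {1}E' -/xo -/xl; ring.
have [A [B [fE Au Bu]]] := lin c1; have [C [D [gE Cu Du]]] := lin c2.
exists (\sum_i c1 i * v i), (\sum_i c2 i * v i) => i0.
have [e [e' [hE eu e'u]]] := base_factor bu um i0.
(* Cramer's rule: the determinant [A * D - B * C] times [F i0] is a combination of the two sums
   given by [c1] and [c2]. At [u] this determinant is 1. *)
pose b i : {mpoly K[3]} := (A * D - B * C) * (i == i0)%:R%:MP
  - (e * D - e' * C) * (c1 i)%:MP - (e' * A - e * B) * (c2 i)%:MP.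
have bF : \sum_i b i * F i = 0.
  have -> : \sum_i b i * F i = (A * D - B * C) * F i0
      - (e * D - e' * C) * \sum_i (c1 i)%:MP * F i - (e' * A - e * B) * \sum_i (c2 i)%:MP * F i.
    transitivity (\sum_i ((if i == i0 then (A * D - B * C) * F i0 else 0)
      - (e * D - e' * C) * ((c1 i)%:MP * F i) - (e' * A - e * B) * ((c2 i)%:MP * F i))).
      apply: eq_bigr => i _; rewrite /b; case: eqVneq => [->|_]; rewrite ?mpolyC1 ?mpolyC0; ring.
    by rewrite !sumrB -big_mkcond big_pred1_eq !mulr_sumr.
  by rewrite fE gE hE -/xo -/xl; ring.
have := syz b bF.
under eq_bigr => i _ do
  rewrite /b !mevalB !mevalM !mevalB !mevalM !mevalC Au Bu Cu Du c1o c1l c2o c2l eu e'u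
     mul1r mul0r subr0 !mulr1 !mulr0 subr0 subr0 !mulrBl.
rewrite !sumrB (bigD1 i0) //= eqxx !mul1r big1 => [|i /negPf ->]; last by rewrite mulr0n mulr0 mul0r.
move/eqP; rewrite addr0 -addrA -opprD subr_eq0 => /eqP ->.
by rewrite !mulr_suml; congr (_ + _); apply: eq_bigr => i _; ring.
Qed.

Lemma plane_factor a (f : {mpoly K[3]}) : (forall y x, f.@[ptm (a * y) y x] = 0) ->
  exists f', f = ('X_o - a *: 'X_m) * f'.
Proof.
move=> f0.
pose lq : 3.-tuple {mpoly K[3]} := [tuple if j == o then a *: 'X_m else 'X_j | j < 3].
have [A AE] := comp_mpoly_factor lq f.
exists (A o); rewrite {1}AE sum_ord3 !tnth_mktuple eqxx (negPf mo) (negPf lo).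
rewrite !subrr !mulr0 !addr0 (_ : f \mPo lq = 0) ?add0r 1?mulrC //.
apply: infinite_mpoly0 => w; rewrite comp_mpoly_meval -(f0 (w m) (w l)).
apply: meval_eq => j; rewrite tnth_mktuple /ptm.
case/or3P: (ord3_cases j) => /eqP ->; rewrite ?eqxx ?(negPf mo) ?(negPf lo) ?(negPf lm).
- by rewrite mevalZ mevalXU.
- by rewrite mevalXU.
- by rewrite mevalXU.
Qed.

(** The linear form is prime: restricted to its plane, polynomials form a domain in which every
    product [g * G i] is zero. If [g] were nonzero there, the form would divide all the [G i]. *)
Lemma coprime_plane a (G Gt : 'I_n.+1 -> {mpoly K[3]}) g :
  coprime_family G -> (forall i, Gt i = g * G i) ->
  (forall i y x, (Gt i).@[ptm (a * y) y x] = 0) ->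
  exists g', g = ('X_o - a *: 'X_m) * g'.
Proof.
move=> coG GtG Gt0; apply: plane_factor => y x.
pose lq : 3.-tuple {mpoly K[3]} := [tuple ptm (a *: 'X_m) 'X_m 'X_l j | j < 3].
have ev (f : {mpoly K[3]}) w : (f \mPo lq).@[w] = f.@[ptm (a * w m) (w m) (w l)].
  rewrite comp_mpoly_meval; apply: meval_eq => j; rewrite tnth_mktuple.
  by case/or3P: (ord3_cases j) => /eqP ->; rewrite !ptmE ?mevalZ !mevalXU.
suff /eqP g0 : g \mPo lq == 0.
  by have := ev g (ptm 0 y x); rewrite !ptmE g0 meval0.
apply/negPn/negP => gn0.
have [] := coG ('X_o - a *: 'X_m).
  move=> i; have [|f' ->] := @plane_factor a (G i); last by exists f'; rewrite mulrC.
  move=> y' x'; suff /eqP G0 : G i \mPo lq == 0.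
    by have := ev (G i) (ptm 0 y' x'); rewrite !ptmE G0 meval0.
  have : (g \mPo lq) * (G i \mPo lq) == 0.
    by apply/eqP/infinite_mpoly0 => w; rewrite mevalM !ev -mevalM -GtG.
  by rewrite mulf_eq0 (negPf gn0).
move=> c [/eqP cn0 E]; apply: cn0.
have := mevalC (fun _ : 'I_3 => 0 : K) c; rewrite -E => <-.
by rewrite mevalB mevalZ !mevalXU mulr0 subr0.
Qed.

Lemma proj_eq_nonzero (v w : 'I_n.+1 -> K) c :
  nonzero v -> (forall i, v i = c * w i) -> proj_eq v w.
Proof.
move=> [i vi] vE; move: (vi); rewrite vE mulf_eq0 negb_or => /andP[cn0 wi].
by split; [exists i | exists c].
Qed.

(* What is needed of the substitution defining G, free of the order of the variables so
   that it serves both G (m = 1, l = 2) and H (m = 2, l = 1). *)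
Definition blowup_chart (Gt : 'I_n.+1 -> {mpoly K[3]}) (p q : {poly K}) : Prop :=
  [/\ forall u, u m = 1 -> (forall i, (F i).@[u] = 0) -> u l = q.[u o] /\ p.[u o] = 0,
      forall i, exists c : {poly K}, forall s, (F i).@[ptm s 1 q.[s]] = c.[s] * p.[s],
      forall i s t, (Gt i).@[ptm s 1 t] = (F i).@[ptm s 1 (q.[s] + t * p.[s])] &
      forall i a y x, p.[a] = 0 -> (Gt i).@[ptm (a * y) y x] = 0].

Definition in_chart (G : 'I_n.+1 -> {mpoly K[3]}) (v : 'I_n.+1 -> K) :=
  exists s t, proj_eq v (evalmap G (ptm s 1 t)).

Lemma scale_pt (u : 'I_3 -> K) : u m != 0 ->
  forall j, u j = u m * ptm (u o / u m) 1 (u l / u m) j.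
Proof.
move=> um j; case/or3P: (ord3_cases j) => /eqP ->; rewrite ptmE ?mulr1 //.
- by rewrite mulrC divfK.
- by rewrite mulrC divfK.
Qed.

(** If [p] vanished at 0, then [(0, 1, q(0))] would be a base point, against (a). Hence [t] can be
    solved for in [q(0) + t p(0) = u l / u m]. *)
Lemma in_chart_image (G Gt : 'I_n.+1 -> {mpoly K[3]}) g p q u v c :
  cond_a F -> blowup_chart Gt p q -> (forall i, Gt i = g * G i) ->
  u o = 0 -> u m != 0 -> nonzero v -> (forall i, v i = c * (F i).@[u]) ->
  in_chart G v.
Proof.
move=> ca [_ S2 T1 _] GtG uo um vn0 vE.
have p0 : p.[0] != 0.
  apply/eqP => p0.
  have [] : base_pt F (ptm 0 1 q.[0]).
    split; first by exists m; rewrite ptmE oner_neq0.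
    by move=> i; have [c' ->] := S2 i; rewrite p0 mulr0.
  move=> h1 h2; have := ca _ (conj h1 h2) o.
  by rewrite ptmE eqxx.
pose t := (u l / u m - q.[0]) / p.[0].
exists 0, t; apply: (proj_eq_nonzero (c := c * u m ^+ d * g.@[ptm 0 1 t])) => // i.
rewrite vE /evalmap -!mulrA -mevalM -GtG T1 (_ : q.[0] + _ = u l / u m).
  congr (_ * _); apply: (dhomog_eval (Fhom i)) => j.
  by rewrite {1}(scale_pt um) uo mul0r.
by rewrite /t divfK // addrC subrK.
Qed.

(** Here [v] is the derivative of [F] at [u] in the direction with [o], [m], [l] coordinates
    [(al, 0, be)]. As [al] is nonzero, some curve [s |-> (s, 1, q(s) + t p(s))] has this tangent
    direction over [a], and the corresponding value of [G] is proportional to [v]. *)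
Lemma in_chart_exceptional (G Gt : 'I_n.+1 -> {mpoly K[3]}) g p q u v al be :
  cond_star F -> coprime_family G -> blowup_chart Gt p q -> (forall i, Gt i = g * G i) ->
  base_pt F u -> u m != 0 -> nonzero v -> al != 0 ->
  (forall i, v i = al * ((F i)^`M(o)).@[u] + be * ((F i)^`M(l)).@[u]) ->
  in_chart G v.
Proof.
move=> star coG [S1 S2 T1 T2] GtG bu um vn0 aln0 vE.
pose a := u o / u m; pose P := ptm a 1 (u l / u m).
have bP : base_pt F P.
  split=> [|i]; first by exists m; rewrite /P ptmE oner_neq0.
  have := dhomog_eval (Fhom i) (scale_pt um); rewrite (proj2 bu) => /esym/eqP.
  by rewrite mulf_eq0 expf_eq0 (negPf um) andbF => /eqP.
have [] := S1 P; rewrite ?/P ?ptmE //; first exact: (proj2 bP).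
move=> ul pa.
have dP j i : ((F i)^`M(j)).@[u] = u m ^+ d.-1 * ((F i)^`M(j)).@[ptm a 1 q.[a]].
  rewrite -ul; apply: dhomog_eval (scale_pt um); exact: dhomog_mderiv.
(* At a double root all [F i] would vanish to second order along [(s, 1, q(s))], so every
   differential would kill its tangent; combining them with [c1] gives 1 = 0. *)
have dpa : p^`().[a] != 0.
  apply/eqP => dpa.
  have [c1 [_ [c1o c1l _ _]]] := base_partials_dual star bu um.
  have : \sum_i c1 i * (((F i)^`M(o)).@[u] + ((F i)^`M(l)).@[u] * q^`().[a]) = 0.
    apply: big1 => i _; rewrite !dP -mulrA -mulrDr.
    have [c hc] := S2 i.
    have E : peval (ptm 'X 1 q) (F i) = c * p.
      apply/eqP; rewrite -subr_eq0; apply/eqP; apply: infinite_poly0 => s.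
      by rewrite hornerD hornerN peval_ptm_horner hornerX hornerC hc hornerM subrr.
    have := deriv_peval_ptm 'X q (F i) a.
    rewrite E derivM !hornerE pa dpa derivX hornerC !mulr0 addr0 mulr1 => <-.
    exact: mulr0.
  under eq_bigr => i _ do rewrite mulrDr mulrA.
  rewrite big_split /= c1o -mulr_suml c1l mul0r addr0 => /eqP.
  by rewrite oner_eq0.
pose t := (be / al - q^`().[a]) / p^`().[a].
have [g' gE] := coprime_plane coG GtG (fun i y x => T2 i a y x pa).
exists a, t.
apply: (proj_eq_nonzero (c := al * u m ^+ d.-1 * g'.@[ptm a 1 t])) => // i.
transitivity (al * (u m ^+ d.-1 * (g' * G i).@[ptm a 1 t])); last first.
  by rewrite mevalM /evalmap; ring.
(* The linear form dividing the common factor restricts to [s - a]. Differentiating at [a] leaves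
   [g' * G i] on one side and a directional derivative of [F i] on the other. *)
have E : peval (ptm 'X 1 (q + t *: p)) (F i) =
    ('X - a%:P) * peval (ptm 'X 1 t%:P) (g' * G i).
  apply/eqP; rewrite -subr_eq0; apply/eqP; apply: infinite_poly0 => s.
  rewrite hornerD hornerN hornerM !peval_ptm_horner !hornerE -T1 GtG gE -mulrA mevalM.
  by rewrite mevalB mevalZ !mevalXU !ptmE mulr1 subrr.
have := deriv_peval_ptm 'X (q + t *: p) (F i) a.
rewrite E derivM !hornerE subrr mul0r addr0 derivXsubC hornerC mul1r.
rewrite peval_ptm_horner !hornerE => ->.
rewrite derivX derivD derivZ !hornerE pa mulr0 addr0.
rewrite /= vE !dP [t * _]divfK // [q^`().[a] + _]addrC subrK.
by field.
Qed.
End Charts.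

(** * Groebner bases and the two charts *)

Section Bases.
Variables (K : closedFieldType) (n : nat) (F : 'I_n.+1 -> {mpoly K[3]}).

Definition i0 : 'I_3 := @Ordinal 3 0 isT.
Definition i1 : 'I_3 := @Ordinal 3 1 isT.
Definition i2 : 'I_3 := @Ordinal 3 2 isT.

Lemma in_ideal_eval (gs : seq {mpoly K[3]}) p u :
  in_ideal gs p -> (forall g, g \in gs -> g.@[u] = 0) -> p.@[u] = 0.
Proof.
move=> [cs [_ ->]] gs0; rewrite raddf_sum big1 // => j _ /=.
by rewrite mevalM (gs0 _ (mem_nth _ (ltn_ord j))) mulr0.
Qed.

Lemma upoly_at_eval (q : {poly K}) (x : {mpoly K[3]}) u :
  (upoly_at q x).@[u] = q.[x.@[u]].
Proof.
rewrite raddf_sum horner_coef; apply: eq_bigr => j _ /=.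
by rewrite mevalM mevalC rmorphXn.
Qed.

Lemma homogen_eval1 (q : {poly K}) e (x y : {mpoly K[3]}) u :
  y.@[u] = 1 -> (homogen q e x y).@[u] = q.[x.@[u]].
Proof.
move=> y1; rewrite raddf_sum horner_coef; apply: eq_bigr => j _ /=.
by rewrite !mevalM mevalC !rmorphXn /= y1 expr1n mulr1.
Qed.

Lemma homogen_eval (q : {poly K}) e (x y : {mpoly K[3]}) u a :
  (size q <= e.+1)%N -> x.@[u] = a * y.@[u] ->
  (homogen q e x y).@[u] = y.@[u] ^+ e * q.[a].
Proof.
move=> sq xy; rewrite raddf_sum horner_coef mulr_sumr; apply: eq_bigr => j _ /=.
have je : (j <= e)%N by rewrite -ltnS (leq_trans (ltn_ord j)).
rewrite !mevalM mevalC !rmorphXn /= xy exprMn -[in RHS](subnKC je) exprD; ring.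
Qed.

Lemma base_ideal_eval X u : X.@[u] = 0 -> (forall i, (F i).@[u] = 0) ->
  forall g, g \in rcons (Fseq F) X -> g.@[u] = 0.
Proof.
move=> Xu Fu g; rewrite mem_rcons inE => /orP[/eqP -> //|].
by case/mapP => i _ ->.
Qed.

Lemma Fseq_mem X i : F i \in rcons (Fseq F) X.
Proof. by rewrite mem_rcons inE map_f ?orbT // mem_enum. Qed.

Lemma size_root_gt0 k (p : {poly K}) a :
  size p = k.+1 -> p \is monic -> p.[a] = 0 -> (0 < k)%N.
Proof.
case: k => // sp pm pa; move: pm; rewrite monicE lead_coefE sp /=.
have := pa; rewrite (size1_polyC (eq_leq sp)) hornerC => ->.
by rewrite coefC /= eq_sym oner_eq0.
Qed.

(** For the last clause: over a root [a] of [p] the homogenized [p] vanishes, so the plane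
    [x_o = a x_m] is sent to multiples of [(a, 1, q(a))], a common zero of the [F i]. *)
Lemma blowup_chart_intro (o m l : 'I_3) d k (p q : {poly K}) (Gt : 'I_n.+1 -> {mpoly K[3]}) :
  m != o -> l != o -> l != m -> (forall i, F i \is d.-homog) ->
  p \is monic -> size p = k.+1 -> (size q <= k)%N ->
  (forall u, u m = 1 -> (forall i, (F i).@[u] = 0) -> u l = q.[u o] /\ p.[u o] = 0) ->
  (forall i, exists c : {poly K}, forall s, (F i).@[ptm o m s 1 q.[s]] = c.[s] * p.[s]) ->
  (forall i u, (Gt i).@[u] = (F i).@[ptm o m (u o * u m ^+ k) (u m ^+ k.+1)
    (u m ^+ 2 * (homogen q k.-1 'X_o 'X_m).@[u] + u l * (homogen p k 'X_o 'X_m).@[u])]) ->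
  blowup_chart F o m l Gt p q.
Proof.
move=> mo lo lm Fhom pm sp sq S1 S2 GtE; split=> // [i s t|i a y x pa].
  rewrite GtE !homogen_eval1 ?mevalXU ?ptmE //.
  by rewrite !expr1n mulr1 mul1r.
(* This makes [k.-1] a true predecessor, so that the exponents 2 and [k.-1] add up to [k.+1]. *)
have k_gt0 := size_root_gt0 sp pm pa.
rewrite GtE !(@homogen_eval _ _ _ _ _ a) ?mevalXU ?ptmE ?sp ?prednK //.
rewrite (@dhomog_eval _ _ _ _ (y ^+ k.+1) (ptm o m a 1 q.[a]) _ (Fhom i)) => [|j].
  by have [c ->] := S2 i; rewrite pa !mulr0.
case/or3P: (ord3_cases mo lo lm j) => /eqP ->; rewrite ptmE // ptmE //.
- by rewrite exprS; ring.
- by rewrite mulr1.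
- by rewrite pa !mulr0 addr0 mulrA -exprD; congr (_ ^+ _ * _); case: k k_gt0 {sp sq GtE}.
Qed.

(** Each inclusion of ideals yields a clause. The basis vanishes at the common zeros of [F] with
    [x_1 = 1]; and on the curve [(s, 1, q(s))] its first two elements vanish, which leaves [F i] a
    multiple of [p]. *)
Lemma Gtilde_blowup_chart d k p q : (forall i, F i \is d.-homog) ->
  gb_shape1 F k p q -> blowup_chart F i0 i1 i2 (Gtilde F k p q) p q.
Proof.
move=> Fhom [pm [sp [sq [FI IF]]]]; apply: (blowup_chart_intro (k := k) _ _ _ Fhom) => //.
- move=> u u1 Fu.
  have z g : g \in rcons (Fseq F) (X1 K - 1) -> g.@[u] = 0.
    by apply: base_ideal_eval => //; rewrite mevalB meval1 mevalXU u1 subrr.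
  split; apply/eqP; first rewrite -subr_eq0; apply/eqP.
    have <- := in_ideal_eval (IF (X2 K - upoly_at q (X0 K)) _) z; last by rewrite inE eqxx.
    by rewrite mevalB upoly_at_eval !mevalXU.
  have <- := in_ideal_eval (IF (upoly_at p (X0 K)) _) z; last by rewrite !inE eqxx !orbT.
  by rewrite upoly_at_eval mevalXU.
- move=> i; have [cs [_ FE]] := FI _ (Fseq_mem (X1 K - 1) i).
  exists (peval (ptm i0 i1 'X 1 q) cs`_2) => s.
  rewrite FE /= !big_ord_recl big_ord0 /= !mevalD !mevalM !mevalB meval0 meval1.
  rewrite !upoly_at_eval !mevalXU (@peval_ptm_horner _ i0 i1 i2) // !hornerE /ptm /=.
  by rewrite !subrr !mulr0 !add0r addr0.
- move=> i u; rewrite comp_mpoly_meval; apply: meval_eq => j.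
  case: j => [[|[|[|//]]] lt]; rewrite (tnth_nth 0) /ptm /=.
  + by rewrite mevalM rmorphXn /= !mevalXU.
  + by rewrite rmorphXn /= !mevalXU.
  + by rewrite mevalD !mevalM !mevalXU.
Qed.

Lemma Htilde_blowup_chart d k p q : (forall i, F i \is d.-homog) ->
  gb_shape2 F k p q -> blowup_chart F i0 i2 i1 (Htilde F k p q) p q.
Proof.
move=> Fhom [pm [sp [sq [FI IF]]]]; apply: (blowup_chart_intro (k := k) _ _ _ Fhom) => //.
- move=> u u2 Fu.
  have z g : g \in rcons (Fseq F) (X2 K - 1) -> g.@[u] = 0.
    by apply: base_ideal_eval => //; rewrite mevalB meval1 mevalXU u2 subrr.
  split; apply/eqP; first rewrite -subr_eq0; apply/eqP.
    have <- := in_ideal_eval (IF (X1 K - upoly_at q (X0 K)) _) z; last by rewrite !inE eqxx orbT.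
    by rewrite mevalB upoly_at_eval !mevalXU.
  have <- := in_ideal_eval (IF (upoly_at p (X0 K)) _) z; last by rewrite !inE eqxx !orbT.
  by rewrite upoly_at_eval mevalXU.
- move=> i; have [cs [_ FE]] := FI _ (Fseq_mem (X2 K - 1) i).
  exists (peval (ptm i0 i2 'X 1 q) cs`_2) => s.
  rewrite FE /= !big_ord_recl big_ord0 /= !mevalD !mevalM !mevalB meval0 meval1.
  rewrite !upoly_at_eval !mevalXU (@peval_ptm_horner _ i0 i2 i1) // !hornerE /ptm /=.
  by rewrite !subrr !mulr0 !add0r addr0.
- move=> i u; rewrite comp_mpoly_meval; apply: meval_eq => j.
  case: j => [[|[|[|//]]] lt]; rewrite (tnth_nth 0) /ptm /=.
  + by rewrite mevalM rmorphXn /= !mevalXU.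
  + by rewrite mevalD !mevalM !mevalXU.
  + by rewrite rmorphXn /= !mevalXU.
Qed.

Lemma chartGP (G : 'I_n.+1 -> {mpoly K[3]}) v : chartG G v <-> in_chart i0 i1 G v.
Proof.
have E s t i : (G i).@[pt3 s 1 t] = (G i).@[ptm i0 i1 s 1 t].
  by apply: meval_eq => -[[|[|[|//]]] ?].
split=> [[s [t [_ [[i Gi] [c [cn0 vE]]]]]]|[s [t [[i Gi] [c [cn0 vE]]]]]]; exists s, t.
  by split; [by exists i; rewrite /evalmap -E|];
    exists c; split=> // j; rewrite vE /evalmap E.
have nz : nonzero (evalmap G (pt3 s 1 t)) by exists i; rewrite /evalmap E.
by do 2?split=> //; exists c; split=> // j; rewrite vE /evalmap E.
Qed.

Lemma chartHP (H : 'I_n.+1 -> {mpoly K[3]}) v : chartH H v <-> in_chart i0 i2 H v.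
Proof.
have E s t i : (H i).@[pt3 s t 1] = (H i).@[ptm i0 i2 s 1 t].
  by apply: meval_eq => -[[|[|[|//]]] ?].
split=> [[s [t [_ [[i Hi] [c [cn0 vE]]]]]]|[t [s [[i Hi] [c [cn0 vE]]]]]].
  by exists s, t; split; [by exists i; rewrite /evalmap -E|];
    exists c; split=> // j; rewrite vE /evalmap E.
exists t, s; have nz : nonzero (evalmap H (pt3 t s 1)) by exists i; rewrite /evalmap E.
by do 2?split=> //; exists c; split=> // j; rewrite vE /evalmap E.
Qed.
End Bases.

(** * The surface as the union of the three charts *)

Lemma proj_eq_homog (K : closedFieldType) (n d : nat) (F : 'I_n.+1 -> {mpoly K[3]})
    v u w (c x : K) :
  (forall i, F i \is d.-homog) -> nonzero v -> (forall i, v i = c * (F i).@[u]) ->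
  (forall j, u j = x * w j) ->
  nonzero (evalmap F w) /\ proj_eq v (evalmap F w).
Proof.
move=> Fhom vn0 vE uE; have E : proj_eq v (evalmap F w).
  apply: (proj_eq_nonzero (c := c * x ^+ d)) => // i.
  by rewrite vE (dhomog_eval (Fhom i) uE) mulrA.
by split=> //; case: E.
Qed.

Theorem mainTheorem2 (K : closedFieldType) (hchar : [pchar K] =i pred0)
  (n : nat) (F G H : 'I_n.+1 -> {mpoly K[3]}) :
  homog_family F ->
  coprime_family F ->
  proj_dim (surfS F) 2 ->
  cond_star F -> cond_a F -> cond_b F ->
  ((~ (exists u, base_pt F u)) /\ G = F /\ H = F) \/
  ((exists u, base_pt F u) /\
    exists (k : nat) (p1 q1 p2 q2 : {poly K}),
      gb_shape1 F k p1 q1 /\ gb_shape2 F k p2 q2 /\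
      divided_by_gcd (Gtilde F k p1 q1) G /\
      divided_by_gcd (Htilde F k p2 q2) H) ->
  forall v : 'I_n.+1 -> K,
    surfS F v <-> (chartF F v \/ chartG G v \/ chartH H v).
Proof.
move=> [d Fhom] coF _ star ca _ data v; split.
- move=> vS; have vn0 := proj1 vS.
  have [u [un0 syz]] := surf_syzygy Fhom vS.
  case: (classic (base_pt F u)) => [bu|nbu].
    case: data => [[nob _]|[_ [k [p1 [q1 [p2 [q2 
      [/(Gtilde_blowup_chart Fhom) fit1 [/(Htilde_blowup_chart Fhom) fit2
      [[coG [g [_ GE]]] [coH [h [_ HE]]]]]]]]]]]]].
      by case: nob; exists u.
    right.
    have [al [be vE]] :=
      @base_exceptional _ _ _ _ Fhom i0 i1 i2 isT isT isT u v star bu (ca u bu i1) syz.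
    have [al0|aln0] := eqVneq al 0; last first.
      left; apply/chartGP.
      exact: (@in_chart_exceptional _ _ _ _ Fhom i0 i1 i2 isT isT isT _ _ _ _ _ _ _ _ _
        star coG fit1 GE bu (ca u bu i1) vn0 aln0 vE).
    right; apply/chartHP.
    (* With [al = 0], Euler's relation trades the column of [i2] for those of [i0] and [i1]; the new
       leading coefficient is nonzero since [be] is, and (a) gives [u i0 != 0]. *)
    have vE' i : v i = - (be * u i0 / u i2) * ((F i)^`M(i0)).@[u] +
        - (be * u i1 / u i2) * ((F i)^`M(i1)).@[u].
      have := euler_base Fhom bu i; rewrite (@sum_ord3 i0 i1 i2 isT isT isT).
      rewrite addrC => /eqP; rewrite addr_eq0 => /eqP /(canRL (mulfK (ca u bu i2))).
      by rewrite vE al0 => ->; ring.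
    have [i vi] := vn0.
    have ben0 : be != 0 by apply: contraNneq vi => be0; rewrite vE al0 be0 !mul0r addr0.
    have ben : - (be * u i0 / u i2) != 0 by rewrite oppr_eq0 !mulf_neq0 ?invr_neq0 // ca.
    exact: (@in_chart_exceptional _ _ _ _ Fhom i0 i2 i1 isT isT isT _ _ _ _ _ _ _ _ _
      star coH fit2 HE bu (ca u bu i2) vn0 ben vE').
  have [i Fi] : exists i, (F i).@[u] != 0.
    apply: NNPP => noi; apply: nbu; split=> // i; apply/eqP/negPn/negP => Fi.
    by apply: noi; exists i.
  have vE j : v j = (v i / (F i).@[u]) * (F j).@[u].
    (* The Koszul syzygy of [F i] and [F j]. *)
    pose b k : {mpoly K[3]} := (if k == j then F i else 0) - (if k == i then F j else 0).
    have bsum (R : comNzRingType) (x y : R) (f : 'I_n.+1 -> R) :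
      \sum_k ((if k == j then x else 0) - (if k == i then y else 0)) * f k = x * f j - y * f i.
      under eq_bigr => k _ do rewrite mulrBl !(fun_if (fun z => z * f k)) !mul0r.
      by rewrite sumrB -!big_mkcond !big_pred1_eq.
    have := syz b; rewrite bsum mulrC subrr => /(_ erefl).
    under eq_bigr => k _ do rewrite mevalB !(fun_if (meval u)) meval0.
    rewrite bsum => /eqP; rewrite subr_eq0 mulrC => /eqP /(canRL (mulfK Fi)) ->.
    by rewrite mulrAC mulrC mulrA mulrAC.
  (* Off the line [x_0 = 0] the chart of [F] contains [u]. On that line [G] serves if [u i1] is
     nonzero, and [H] otherwise. *)
  have [u0|u0] := eqVneq (u i0) 0; last first.
    left; exists (u i1 / u i0), (u i2 / u i0); apply: (proj_eq_homog Fhom vn0 vE (x := u i0)).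
    by move=> j; rewrite mulrC;
      case/or3P: (@ord3_cases i0 i1 i2 isT isT isT j) => /eqP ->; rewrite /pt3 /= ?mul1r ?divfK.
  right; case: data => [[_ [-> ->]]|[_ [k [p1 [q1 [p2 [q2 
      [/(Gtilde_blowup_chart Fhom) fit1 [/(Htilde_blowup_chart Fhom) fit2
      [[coG [g [_ GE]]] [coH [h [_ HE]]]]]]]]]]]]].
    have [u1|u1] := eqVneq (u i1) 0; [right|left].
      exists 0, 0; apply: (proj_eq_homog Fhom vn0 vE (x := u i2)).
      by move=> j;
      case/or3P: (@ord3_cases i0 i1 i2 isT isT isT j) => /eqP ->; rewrite /pt3 /= ?mulr0 ?mulr1 ?u0 ?u1.
    exists 0, (u i2 / u i1); apply: (proj_eq_homog Fhom vn0 vE (x := u i1)).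
    by move=> j; rewrite mulrC;
      case/or3P: (@ord3_cases i0 i1 i2 isT isT isT j) => /eqP ->; rewrite /pt3 /= ?mul0r ?mul1r ?divfK ?u0.
  have [u1|u1] := eqVneq (u i1) 0; [right; apply/chartHP|left; apply/chartGP].
    have u2 : u i2 != 0.
      have [j uj] := un0; apply: contraNneq uj => u2.
      case/or3P: (@ord3_cases i0 i1 i2 isT isT isT j) => /eqP ->; by rewrite ?u0 ?u1 ?u2.
    exact: (@in_chart_image _ _ _ _ Fhom i0 i2 i1 isT isT isT _ _ _ _ _ _ _ _
      ca fit2 HE u0 u2 vn0 vE).
  exact: (@in_chart_image _ _ _ _ Fhom i0 i1 i2 isT isT isT _ _ _ _ _ _ _ _
      ca fit1 GE u0 u1 vn0 vE).
(* Conversely, each chart lies in the surface; for [F] itself the substitution is the identity and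
   the common factor is 1. *)
have nz w : proj_eq v w -> nonzero v.
  by move=> [[i wi] [c [cn0 vE]]]; exists i; rewrite vE mulf_neq0.
have inF w : proj_eq v (evalmap F w) -> surfS F v.
  move=> vw; apply: (@chart_in_surf _ _ F F F 1 id w v coF) (nz _ vw) vw => // [|i].
    exact: oner_neq0.
  by rewrite mul1r.
move=> [[s [t [_ /inF]]]|[[s [t [_ vw]]]|[s [t [_ vw]]]]] //.
- case: data vw => [[_ [-> _]] /inF //|[_ [k [p1 [q1 [p2 [q2 [_ [_ [[_ [g [gn0 GE]]] _]]]]]]]]]] vw.
  apply: (chart_in_surf coF _ gn0 GE (nz _ vw) vw) => w i.
  exact: comp_mpoly_meval.
- case: data vw => [[_ [_ ->]] /inF //|[_ [k [p1 [q1 [p2 [q2 [_ [_ [_ [_ [h [hn0 HE]]]]]]]]]]]]] vw.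
  apply: (chart_in_surf coF _ hn0 HE (nz _ vw) vw) => w i.
  exact: comp_mpoly_meval.
Qed.
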